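(* Let $n,s,k,q$ be positive integers with $1\le s\le n-2$, $\gcd(n,s)=1$ and $q\le k$. Then there exists an $s$-overlap cycle of the set of all words of weight $k$ and length $n$ over the $(q+1)$-letter alphabet $\{0,1,\ldots,q\}$.
   Context: A word of length $n$ over $\{0,1,\ldots,q\}$ is a sequence $w=w_1w_2\cdots w_n$ with each $w_i\in\{0,1,\ldots,q\}$. Its weight is $\sum_{i=1}^n w_i$. For a finite set $W$ of words of length $n$ and $1\le s\le n-2$, an $s$-overlap cycle ($s$-ocycle) of $W$ is a cyclic ordering $w^{(1)},\ldots,w^{(N)}$ of all the words of $W$, each occurring exactly once, such that for every $i$ (with $w^{(N+1)}=w^{(1)}$) the last $s$ letters of $w^{(i)}$, in order, coincide with the first $s$ letters of $w^{(i+1)}$, in order. Equivalently, it is a cyclic string of length $(n-s)N$ in which the length-$n$ windows starting at successive multiples of $n-s$ run through every word of $W$ exactly once. *)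

(* Defs.v *)
From mathcomp Require Import all_boot.
Set Implicit Arguments.
Unset Strict Implicit.
Unset Printing Implicit Defensive.

Definition word (q n : nat) := n.-tuple 'I_q.+1.

Definition weight (q n : nat) (w : word q n) : nat := \sum_(i < n) tnth w i.

Definition overlap (q n s : nat) : rel (word q n) :=
  fun u v => drop (n - s) u == take s v.

(* The sequence [c] lists [W] without repetition, and [cycle] also imposes the
   overlap from the last word of [c] back to the first.  The empty sequence is
   the ocycle of the empty set. *)
Definition ocycle (q n s : nat) (W : {set word q n}) (c : seq (word q n)) :
    Prop :=
  [/\ uniq c, c =i W & cycle (overlap s) c].

(* Main.v *)
Require Import Defs.
From mathcomp Require Import all_boot.
From mathcomp Require Import perm.
From mathcomp Require Import zify.

(** Regard each word of length [n] as an arrow from its first [s] letters to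
    its last [s] letters; an [s]-ocycle of the words of weight [k] is then an
    Eulerian circuit of the arrows of weight [k].

    Rotation by [n - s] letters preserves the weight and sends each word to one
    that may follow it, so its orbits already decompose the arrows into closed
    trails.  When two arrows of equal weight with the same end lie on different
    closed trails, exchanging their successors splices these trails into one.
    A decomposition with the fewest trails ([exists_spliced_perm]) therefore
    keeps together all words that agree on their last [s] letters, and then
    also every word and its rotation by [n - s].

    It remains to see that one trail contains all words of weight [k].  As
    [n - s] is coprime to [n], a trail is closed under all rotations
    ([inv_rot_coprime]).  As [s <= n - 2], it is also closed under altering the
    first two letters without changing their sum, and, after a rotation, under
    altering any two adjacent letters in this way.  Such alterations connect
    all words of equal length and weight ([inv_adjacent_transfer]). *)

Set Implicit Arguments.
Unset Strict Implicit.
Unset Printing Implicit Defensive.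

(** * Splicing closed trails *)

(** The hypothesis says that [s0] decomposes the arrows of a finite directed
    graph into closed trails.  With as few trails as possible, two arrows [x]
    and [y] with the same target cannot lie on different trails: composing with
    the transposition of [x] and [y] would merge the two. *)
Lemma exists_spliced_perm (T : finType) (K : eqType) (src tgt : T -> K)
    (s0 : {perm T}) :
  (forall x, src (s0 x) = tgt x) ->
  exists2 s : {perm T}, forall x, src (s x) = tgt x &
    forall x y, tgt x = tgt y -> porbit s x = porbit s y.
Proof.
move=> s0P.
pose good (s : {perm T}) := [forall x, src (s x) == tgt x].
have good0 : good s0 by apply/forallP => x; rewrite s0P.
case: (arg_minnP (fun s : {perm T} => #|porbits s|) good0) => s /forallP sP smin.
exists s => [x|x y exy]; first exact/eqP.
apply/eqP; rewrite eq_porbit_mem; apply/negPn/negP => xNy.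
have nxy : x != y by apply: contraNneq xNy => ->; rewrite porbit_id.
have /smin : good (tperm x y * s)%g.
  apply/forallP => z; rewrite permM (eqP (sP _)).
  by case: tpermP => [->|->|//]; rewrite exy.
have /= := porbits_mul_tperm s x y.
by rewrite xNy nxy; lia.
Qed.

(** The predecessor of [y] on its own trail has the same target as [x]. *)
Lemma spliced_src (T : finType) (K : eqType) (src tgt : T -> K)
    (s : {perm T}) :
  (forall x, src (s x) = tgt x) ->
  (forall x y, tgt x = tgt y -> porbit s x = porbit s y) ->
  forall x y, tgt x = src y -> porbit s x = porbit s y.
Proof.
move=> sP spl x y exy; rewrite -(permKV s y) in exy *.
rewrite (spl x ((s^-1)%g y)) ?exy ?sP //.
by apply/esym/eqP; rewrite eq_porbit_mem; exact: (mem_porbit s 1).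
Qed.

Lemma cycle_porbit_traject (T : finType) (s : {perm T}) (x : T) :
  fcycle s (traject s x #|porbit s x|).
Proof.
have: 0 < #|porbit s x| by apply/card_gt0P; exists x; rewrite porbit_id.
case Em: #|porbit s x| => [//|m] _ /=.
rewrite rcons_path fpath_traject /= last_traject.
by rewrite -iterS -Em iter_porbit.
Qed.

(** * Invariance under transfers between adjacent letters *)

Definition letter_sum (q : nat) (l : seq 'I_q.+1) : nat := \sum_(a <- l) a.

Lemma weightE (q n : nat) (w : word q n) : weight w = letter_sum w.
Proof. by rewrite /letter_sum big_tuple. Qed.

Definition adjacent_inv (q : nat) (T : Type) (f : seq 'I_q.+1 -> T) : Prop :=
  forall l1 l2 (a b a' b' : 'I_q.+1), a + b = a' + b' ->
    f (l1 ++ [:: a, b & l2]) = f (l1 ++ [:: a', b' & l2]).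

(** Make the first letters agree, then recurse on the tails.  If the first
    letter [a] of [u] is the smaller one, the tail of [u] has positive weight;
    by the induction hypothesis the tail may be reordered so that it starts
    with a nonzero letter, and one unit of that letter is transferred to [a]. *)
Lemma inv_adjacent_transfer (q : nat) (T : Type) (f : seq 'I_q.+1 -> T) :
  adjacent_inv f -> forall u v,
  size u = size v -> letter_sum u = letter_sum v -> f u = f v.
Proof.
move=> finv u; have [m] := ubnP (size u).
elim: m => // m IH in f finv u * => + [|b v] //; case: u => [|a u] // ltm [eq_sz].
have tailE c u1 u2 : size u1 = size u -> size u2 = size u ->
    letter_sum u1 = letter_sum u2 -> f (c :: u1) = f (c :: u2).
  move=> sz1 sz2; apply: (IH (f \o cons c)); rewrite ?sz1 ?sz2 //.
  by move=> l1 l2 *; apply: (finv (c :: l1)).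
rewrite /letter_sum !big_cons -!/(letter_sum _) => {ltm IH}.
wlog leab : a b u v eq_sz tailE / a <= b.
  move=> gen eq_sum; case: (leqP a b) => [|/ltnW] leab; first exact: gen.
  by apply/esym/gen => //; rewrite -eq_sz.
have [d] := ubnP (b - a).
elim: d => // d IHd in a u leab eq_sz tailE * => ltd eq_sum.
have [eqab|ltab] := eqVneq a b.
  by rewrite -eqab in eq_sum *; apply: tailE => //; lia.
have {}ltab : a < b by rewrite ltn_neqAle leab andbT.
have /hasP[c cu c_gt0] : has (fun c : 'I_q.+1 => 0 < c) u.
  apply: contraT => /hasPn u0.
  have u_sum0 : letter_sum u = 0 by apply: big1_seq => c /= /u0; lia.
  by lia.
have perm_u := perm_to_rem cu.
have a1P : a.+1 < q.+1 by have := ltn_ord b; lia.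
have c1P : c.-1 < q.+1 by have := ltn_ord c; lia.
have sum_u : letter_sum u = c + letter_sum (rem c u).
  by rewrite /letter_sum (perm_big _ perm_u) big_cons.
rewrite (tailE a u (c :: rem c u)) ?(perm_size perm_u) //; last first.
  by rewrite sum_u /letter_sum big_cons.
rewrite (finv [::] _ _ _ (Ordinal a1P) (Ordinal c1P)) /=; last lia.
apply: IHd => //=.
- by rewrite -eq_sz (perm_size perm_u).
- by rewrite -(perm_size perm_u : size u = (size (rem c u)).+1).
- lia.
- by rewrite -eq_sum sum_u /letter_sum big_cons /=; lia.
Qed.

(** * Invariance under rotations *)

Lemma iter_rot_lt (T : Type) (m i : nat) (l : seq T) : m < size l ->
  iter i (rot m) l = rot (i * m %% size l) l.
Proof.
move=> ltm; elim: i => [|i IH]; first by rewrite mod0n rot0.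
have ltr : i * m %% size l < size l by rewrite ltn_pmod //; lia.
rewrite iterS IH rot_add_mod ?(ltnW ltr) ?(ltnW ltm) // mulSn -modnDmr.
move: (i * m %% size l) ltr => r ltr.
have [le|lt] := leqP; last first.
  by rewrite -[in RHS](subnK (ltnW lt)) modnDr modn_small //; lia.
have [->|ne] := eqVneq (m + r) (size l).
  by rewrite modnn rot_size rot0.
by rewrite modn_small //; lia.
Qed.

(** The multiples of [m] exhaust the residues modulo the length. *)
Lemma inv_rot_coprime (T U : Type) (f : seq T -> U) (n m : nat) :
  m < n -> coprime n m ->
  (forall l, size l = n -> f (rot m l) = f l) ->
  forall l i, size l = n -> i < n -> f (rot i l) = f l.
Proof.
move=> ltm co fm l i szl lti.
pose j := chinese n m i 0.
have /dvdnP[t jE] : m %| j.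
  by rewrite /dvdn chinese_modr // mod0n.
have -> : rot i l = iter t (rot m) l.
  by rewrite iter_rot_lt szl // -jE chinese_modl // modn_small.
elim: t {jE} => //= t IH; rewrite fm ?IH //.
by elim: t {IH} => //= t; rewrite size_rot.
Qed.

(** * The overlap cycle *)

Theorem mainTheorem3 (n s k q : nat)
    (n_gt0 : 0 < n) (k_gt0 : 0 < k) (q_gt0 : 0 < q)
    (s_ge1 : 1 <= s) (s_le : s <= n - 2)
    (coprime_ns : gcdn n s = 1) (q_le_k : q <= k) :
  exists c : seq (word q n), ocycle s [set w : word q n | weight w == k] c.
Proof.
have le_sn : s <= n by lia.
have [w0 /eqP w0k|noW] := pickP [pred w : word q n | weight w == k]; last first.
  by exists [::]; split=> // w; rewrite !inE; have /= -> := noW w.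
pose src (w : word q n) := (weight w, take s w).
pose tgt (w : word q n) := (weight w, drop (n - s) w).
pose r (w : word q n) : word q n := [tuple of rot (n - s) w].
have r_inj : injective r by move=> u v [] /rot_inj /val_inj.
have srcr w : src (r w) = tgt w.
  congr pair; first by rewrite !weightE; apply/perm_big; rewrite perm_rot.
  by rewrite /= /rot take_size_cat // size_drop size_tuple; lia.
have [|p pP spl] := @exists_spliced_perm _ _ src tgt (perm r_inj).
  by move=> w; rewrite permE.
have spl_src := spliced_src pP spl.
(* The trail through a word, read on plain sequences; a sequence of another
   length has none. *)
pose f (l : seq 'I_q.+1) := omap (porbit p) (insub l : option (word q n)).
have fE (w : word q n) : f w = Some (porbit p w) by rewrite /f valK.
have f_size l : size l != n -> f l = None by move=> szl; rewrite /f insubN.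
have f_rot l i : size l = n -> i < n -> f (rot i l) = f l.
  apply: (@inv_rot_coprime _ _ f n (n - s)); first lia.
    by rewrite /coprime -[X in gcdn X](subnK le_sn) gcdnC gcdnDl gcdnC
               -(gcdnDr s) subnK // gcdnC coprime_ns.
  move=> {}l /eqP szl; have := fE (r (Tuple szl)); have := fE (Tuple szl).
  by rewrite /= => -> ->; rewrite (spl_src (Tuple szl) (r (Tuple szl))) ?srcr.
have f_adj : adjacent_inv f.
  move=> l1 l2 a b a' b' eq_sum.
  have [szl|szl] := eqVneq (size (l1 ++ [:: a, b & l2])) n; last first.
    by rewrite !f_size //; move: szl; rewrite !size_cat.
  have szl' : size (l1 ++ [:: a', b' & l2]) = n.
    by rewrite -szl !size_cat.
  have lt1 : size l1 < n by move: szl; rewrite size_cat /=; lia.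
  rewrite -(f_rot _ _ szl lt1) -(f_rot _ _ szl' lt1) !rot_size_cat.
  have sz : size ([:: a, b & l2] ++ l1) == n by rewrite -szl !size_cat addnC.
  have sz' : size ([:: a', b' & l2] ++ l1) == n by rewrite -szl !size_cat addnC.
  have := fE (Tuple sz); have := fE (Tuple sz'); rewrite /= => -> ->.
  congr Some; apply: spl; congr pair.
    by rewrite !weightE /letter_sum /= !big_cons !addnA eq_sum.
  have : 2 <= n - s by lia.
  by rewrite /=; case: (n - s) => [|[|d]].
have memW w : (w \in porbit p w0) = (weight w == k).
  apply/idP/eqP => [|wk].
    have srcW x : weight (p x) = weight x by have [] := pP x.
    case/porbitP => i ->; rewrite permX -w0k.
    by elim: i => //= i <-; rewrite srcW.
  have : f w = f w0.
    by apply: (inv_adjacent_transfer f_adj); rewrite ?size_tuple // -!weightE wk.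
  by rewrite !fE => -[<-]; apply: porbit_id.
exists (traject p w0 #|porbit p w0|); split.
- exact: uniq_traject_porbit.
- by move=> w; rewrite -porbit_traject memW inE.
- apply: sub_cycle (cycle_porbit_traject p w0) => x y /eqP <-.
  by have [_ e] := pP x; rewrite /overlap e.
Qed.
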